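(* Let $\Gamma=(G,\sigma)$ be a connected signed graph containing at least one cycle, with girth $g$, and let $C_g^\sigma$ be a shortest cycle of $\Gamma$. Then $i_+(\Gamma)\ge\lceil g/2\rceil-1$. Moreover, equality holds if and only if one of the following holds: (1) $\Gamma=C_g^\sigma$ is a cycle, and either $C_g^\sigma$ is balanced with $g\equiv 0,3\pmod 4$, or $C_g^\sigma$ is unbalanced with $g\equiv 1,2\pmod 4$; (2) $\Gamma$ is switching equivalent to $(K_{n_1,n_2,\dots,n_l},+)$ for some $l\ge 2$ (the complete multipartite graph with all edges positive).
   Context: A signed graph $\Gamma=(G,\sigma)$ is a simple graph $G$ with a sign function $\sigma:E(G)\to\{+,-\}$; $(G,+)$ denotes all edges positive. Its adjacency matrix $A(\Gamma)$ has $(u,v)$-entry $\sigma(uv)$ if $uv\in E(G)$ and $0$ otherwise; $i_+(\Gamma)$ is the number of positive eigenvalues of $A(\Gamma)$. A cycle is balanced if the product of its edge signs is $+$, unbalanced otherwise. Switching by $\theta:V\to\{+,-\}$ replaces $\sigma(xy)$ by $\theta(x)\sigma(xy)\theta(y)$; switching equivalent signed graphs are related by a switching. The girth is the length of a shortest cycle. $K_{n_1,\dots,n_l}$ is the complete multipartite graph with parts of sizes $n_1,\dots,n_l$. *)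

(* Defs.v *)
From mathcomp Require Import all_boot all_order all_algebra.
From mathcomp Require Import reals.
From mathcomp.real_closed Require Import polyrcf.
Set Implicit Arguments. Unset Strict Implicit. Unset Printing Implicit Defensive.
Import Order.TTheory GRing.Theory Num.Theory.

(* A signed graph on the vertex set 'I_n is given by
   - adj : rel 'I_n, the (simple) underlying graph G,
   - neg : rel 'I_n, the sign function: for an edge xy, sigma(xy) = - iff neg x y. *)

Definition simple_graph n (adj : rel 'I_n) :=
  irreflexive adj /\ symmetric adj.

Definition sign_sym n (adj neg : rel 'I_n) :=
  forall x y, adj x y -> neg x y = neg y x.

Definition connected_graph n (adj : rel 'I_n) := forall x y, connect adj x y.

Definition sadj_mx (R : realType) n (adj neg : rel 'I_n) : 'M[R]_n :=
  \matrix_(i, j) (if adj i j then (if neg i j then -1 else 1) else 0)%R.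

Definition npos_eig (R : realType) n (A : 'M[R]_n) : nat :=
  let p := char_poly A in
  (\sum_(x <- rootsR p | (0 < x)%R) mup x p)%N.

Definition ipos (R : realType) n (adj neg : rel 'I_n) : nat :=
  npos_eig (sadj_mx R adj neg).

Definition is_cycle n (adj : rel 'I_n) (s : seq 'I_n) :=
  [&& 3 <= size s, uniq s & cycle adj s].

Definition shortest_cycle n (adj : rel 'I_n) (s : seq 'I_n) :=
  is_cycle adj s /\ forall t, is_cycle adj t -> size s <= size t.

Definition cycle_edge n (s : seq 'I_n) (x y : 'I_n) :=
  (x \in s) && ((next s x == y) || (prev s x == y)).

Definition graph_is_cycle n (adj : rel 'I_n) (s : seq 'I_n) :=
  (forall x, x \in s) /\ (forall x y, adj x y = cycle_edge s x y).

Definition balanced_cycle n (neg : rel 'I_n) (s : seq 'I_n) :=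
  ~~ odd (count (fun x => neg x (next s x)) s).

(* Gamma is switching equivalent to (K_{n_1,...,n_l}, +):
   there is a partition of the vertices into l nonempty parts (part : 'I_n -> 'I_l onto)
   such that x,y are adjacent iff they lie in different parts, and a switching
   theta (true = -) making every edge positive. *)
Definition switch_complete_multipartite n (adj neg : rel 'I_n) :=
  exists l (part : 'I_n -> 'I_l) (theta : 'I_n -> bool),
    [/\ 2 <= l,
        (forall k : 'I_l, exists x, part x = k),
        (forall x y, adj x y = (part x != part y)) &
        (forall x y, adj x y -> (theta x (+) neg x y (+) theta y) = false)].

(* Main.v *)
(* Over R[i] the real symmetric matrix A is unitarily diagonalizable with real
   eigenvalues, so the number i_+ of positive ones is at least the dimension of
   any real space on which the quadratic form of A is positive definite, and at
   most the codimension of any real space on which it is nonpositive.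

   A shortest cycle has no chord.  After switching its first g - 1 edges to +,
   the form of the cycle is twice  y_0 y_1 + ... + y_{g-2} y_{g-1} + e y_{g-1} y_0,
   where e is the product of the edge signs.  With m = ceil(g/2) - 1 and the
   convention y_{2m+1} = e y_0 for odd g, it telescopes to
     sum_{j<m} (y_{2j+1} + y_{2j+3}) (y_{2j+2} + (-1)^j y_0)
       + ((-1)^m + e [g even]) y_0 y_{2m+1},
   hence i_+ >= m, and a cycle graph has i_+ = m exactly when e = -(-1)^m.

   If g >= 5 and the graph is not just the cycle, some vertex has a single
   neighbour on it, which makes the form positive on a space of dimension m + 1.
   If g <= 4 then m = 1, and i_+ = 1 forbids an edge xy together with a
   non-isolated vertex adjacent to neither x nor y, as well as unbalanced
   triangles and unbalanced induced 4-cycles: non-adjacency is then an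
   equivalence relation and all signs can be switched to +.  Conversely the
   form of a complete multipartite graph is nonpositive on the hyperplane where
   the coordinates sum to 0. *)
Require Import Defs.
From mathcomp Require Import all_boot all_order all_algebra.
From mathcomp Require Import reals.
From mathcomp.real_closed Require Import polyrcf complex.
From mathcomp Require Import ring lra zify.
Set Implicit Arguments. Unset Strict Implicit. Unset Printing Implicit Defensive.
Import Order.TTheory GRing.Theory Num.Theory.
Local Open Scope ring_scope.
Local Open Scope sesquilinear_scope.

Definition qform (R : pzRingType) n (A : 'M[R]_n) (x : 'rV[R]_n) : R :=
  (x *m A *m x^T) 0 0.

(** * Inertia of real symmetric matrices *)

Section Inertia.
Variables (R : realType) (n : nat).
Local Notation toC := (map_mx (real_complex R)).
Implicit Types (A : 'M[R]_n).

Lemma toC_real m p (B : 'M[R]_(m, p)) : toC B \is a mxOver Num.real.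
Proof. by apply/mxOverP => i j; rewrite mxE complex_real. Qed.

Lemma toC_conj m p (B : 'M[R]_(m, p)) : (toC B) ^t* = toC B^T.
Proof. by apply/matrixP => i j; rewrite !mxE; apply: conj_Creal; rewrite complex_real. Qed.

Lemma mx_toC_ReIm m p (B : 'M[R[i]]_(m, p)) :
  B = toC (map_mx (@complex.Re R) B) + 'i%C *: toC (map_mx (@complex.Im R) B).
Proof. by apply/matrixP => i j; rewrite !mxE -complexE. Qed.

Lemma toC_ReIm_inj m p (a b : 'M[R]_(m, p)) :
  toC a + 'i%C *: toC b = 0 -> a = 0 /\ b = 0.
Proof.
move=> /matrixP h; split; apply/matrixP => i j; move: (h i j); rewrite !mxE;
by simpc => /eqP; rewrite eq_complex /= => /andP[/eqP ? /eqP ?].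
Qed.

(** The cross terms in [a] and [b] cancel because [A] is symmetric, so the sign of the form at a
    complex vector is decided by two real ones. *)
Lemma hermitian_form_ReIm A (a b : 'rV[R]_n) : A^T = A ->
  let x := toC a + 'i%C *: toC b in
  (x *m toC A *m x^t*) 0 0 = (qform A a + qform A b)%:C%C.
Proof.
move=> symA x.
have -> : x^t* = toC a^T - 'i%C *: toC b^T.
  rewrite /x -!toC_conj; apply/matrixP => i j; rewrite !mxE rmorphD rmorphM /=.
  by simpc.
have ba : b *m A *m a^T = a *m A *m b^T.
  have -> : b *m A *m a^T = (a *m A *m b^T)^T by rewrite !trmx_mul trmxK symA mulmxA.
  by apply/matrixP => i j; rewrite !ord1 mxE.
rewrite /x mulmxDl mulmxDl !mulmxBr -!scalemxAl -!scalemxAr -!map_mxM.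
rewrite ba /qform; set aa := a *m A *m _; set bb := b *m A *m _.
rewrite !mxE; move: (\sum_j _) (\sum_j _) (\sum_j _) => s1 s2 s3.
by apply/eqP; rewrite eq_complex /=; apply/andP; split; apply/eqP; ring.
Qed.


(** [A] is Hermitian over [R[i]], so its eigenvalues are real and descend to [r]; characteristic
    polynomials are compared through the injection of [R] into [R[i]]. *)
Lemma real_symmetric_spectral A : A^T = A ->
  exists r : 'rV[R]_n, exists P : 'M[R[i]]_n,
   [/\ P \is unitarymx, toC A = P^t* *m diag_mx (toC r) *m P
     & char_poly A = \prod_(i < n) ('X - (r 0 i)%:P)].
Proof.
move=> symA.
have hA : toC A \is hermsymmx.
  apply: realsym_hermsym; last exact: toC_real.
  by apply/is_hermitianmxP; rewrite expr0 scale1r map_mx_id // map_trmx symA.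
have dR := hermitian_spectral_diag_real hA.
have eqA := orthomx_spectralP (hermitian_normalmx hA).
set P := spectralmx _ in eqA; set d := spectral_diag _ in dR eqA.
have uP : P \is unitarymx := spectral_unitarymx _.
pose r := map_mx (@complex.Re R) d.
have dE : d = toC r.
  by apply/rowP => j; rewrite !mxE RRe_real //; exact: (mxOverP dR).
exists r, P; split => //; first by rewrite -dE -invmx_unitary.
have inj := map_inj_poly (@complexI R) (rmorph0 (real_complex R)).
apply: inj; rewrite map_char_poly /= eqA rmorph_prod /=.
have Pu := unitarymx_unit uP.
rewrite /char_poly /char_poly_mx.
have -> : 'X%:M - map_mx polyC (invmx P *m diag_mx d *m P) =
    map_mx polyC (invmx P) *m ('X%:M - map_mx polyC (diag_mx d)) *m map_mx polyC P.
  rewrite !map_mxM mulmxBr mulmxBl; congr (_ - _).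
  by rewrite scalar_mxC -mulmxA -map_mxM mulVmx // map_mx1 mulmx1.
rewrite !det_mulmx mulrC mulrA -det_mulmx -map_mxM mulmxV // map_mx1 det1 mul1r.
rewrite -[LHS]/(char_poly _) char_poly_trig ?diag_mx_is_trig //.
by apply: eq_bigr => i _; rewrite map_polyXsubC /= dE !mxE eqxx.
Qed.

(** The multiplicity of a root is its number of occurrences among the entries of [r], so the sum
    over distinct roots counts indices. *)
Lemma npos_eig_prod A (r : 'rV[R]_n) :
  char_poly A = \prod_(i < n) ('X - (r 0 i)%:P) ->
  npos_eig A = #|[pred i | 0 < r 0 i]|.
Proof.
rewrite /npos_eig => cA; have pn0 : char_poly A != 0 := monic_neq0 (char_poly_monic A).
pose s := [seq r 0 i | i <- enum 'I_n].
have cs : char_poly A = \prod_(y <- s) ('X - y%:P) by rewrite cA big_map big_enum.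
transitivity (\sum_(x <- rootsR (char_poly A) | (0 < x)%R) count_mem x s)%N.
  by apply: eq_bigr => x _; rewrite cs mu_prod_XsubC.
transitivity (count (fun x => 0 < x) s); last first.
  by rewrite count_map -sum1_count big_enum_cond /= sum1_card.
have : all (mem (rootsR (char_poly A))) s.
  apply/allP => x xs; rewrite inE -(roots_on_rootsR pn0) in_itv /= cs.
  by rewrite root_prod_XsubC.
elim: (s) => [|x t IH] /=; first by rewrite big1.
move=> /andP[xr /IH <-]; rewrite big_split /=; congr (_ + _)%N.
rewrite -big_mkcondr /= sum1_count /=.
case: (ltrP 0 x) => x0 /=.
  rewrite (eq_count (a2 := pred1 x)) ?count_uniq_mem ?xr ?uniq_roots //.
  by move=> y /=; rewrite eq_sym; case: eqP => [->|]; rewrite ?x0 ?andbF.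
rewrite (eq_count (a2 := pred0)) ?count_pred0 // => y /=.
by case: eqP => [<-|]; rewrite ?andbF // andbT ltNge x0.
Qed.
End Inertia.

Lemma mul_kernel_nontrivial (F : fieldType) a b (M : 'M[F]_(a, b)) :
  (b < a)%N -> exists2 u : 'rV_a, u != 0 & u *m M = 0.
Proof.
move=> ltba; have : kermx M != 0.
  by rewrite -mxrank_eq0 mxrank_ker subn_eq0 -ltnNge (leq_ltn_trans (rank_leq_col M)).
by case/rowV0Pn => u /sub_kermxP uM u0; exists u.
Qed.

Section InertiaBounds.
Variables (R : realType) (n : nat) (A : 'M[R]_n).
Hypothesis symA : A^T = A.
Local Notation toC := (map_mx (real_complex R)).

Lemma diag_form (r : 'rV[R]_n) (y : 'rV[R[i]]_n) :
  (y *m diag_mx (toC r) *m y^t*) 0 0 = \sum_i (r 0 i)%:C%C * `|y 0 i| ^+ 2.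
Proof.
rewrite mul_mx_diag mxE; apply: eq_bigr => i _.
by rewrite !mxE mulrAC normCK mulrC.
Qed.

(** With fewer than [k] positive eigenvalues, some nonzero complex combination of the rows of [W]
    has no component along their eigenvectors, so its form is nonpositive; its real or imaginary
    part contradicts [posW]. *)
Lemma npos_eig_ge k (W : 'M[R]_(k, n)) :
  (forall t, t != 0 -> 0 < qform A (t *m W)) -> (k <= npos_eig A)%N.
Proof.
move=> posW; have [r [P [uP eqA cA]]] := real_symmetric_spectral symA.
rewrite (npos_eig_prod cA) leqNgt; apply/negP => lt_k.
set pos := [pred i | 0 < r 0 i] in lt_k.
have [u u0 uM] := mul_kernel_nontrivial
  (toC W *m P^t* *m colsub (@enum_val _ pos) 1%:M) lt_k.
pose y := u *m toC W *m P^t*.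
have y0 i : 0 < r 0 i -> y 0 i = 0.
  move=> ri; have ip : i \in pos by [].
  move/rowP: uM => /(_ (enum_rank_in ip i)).
  by rewrite !mulmxA mulmx_colsub mulmx1 !mxE enum_rankK_in // => <-; rewrite !mxE.
have h1 : (u *m toC W *m toC A *m (u *m toC W)^t*) 0 0 <= 0.
  have -> : u *m toC W *m toC A *m (u *m toC W)^t* = y *m diag_mx (toC r) *m y^t*.
    by rewrite eqA /y [in RHS]trmx_mul [in RHS]map_mxM trmxCK !mulmxA.
  rewrite diag_form; apply: sumr_le0 => i _; case: (ltrP 0 (r 0 i)) => ri.
    by rewrite y0 // normr0 expr0n mulr0.
  by rewrite mulr_le0_ge0 ?exprn_ge0 // lecR.
move: h1; set a := map_mx (@complex.Re R) u; set b := map_mx (@complex.Im R) u.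
have -> : u *m toC W = toC (a *m W) + 'i%C *: toC (b *m W).
  by rewrite [u in LHS]mx_toC_ReIm mulmxDl -scalemxAl !map_mxM.
rewrite hermitian_form_ReIm // lecR leNgt => /negP; apply.
have ge0 t : 0 <= qform A (t *m W).
  have [->|/posW/ltW //] := eqVneq t 0.
  by rewrite /qform !mul0mx mxE.
have [a0|/posW ? ] := eqVneq a 0; last by rewrite ltr_wpDr.
have [b0|/posW ? ] := eqVneq b 0; last by rewrite ltr_wpDl.
by case/eqP: u0; rewrite (mx_toC_ReIm u) -/a -/b a0 b0 !map_mx0 scaler0 addr0.
Qed.

(** Dually, the eigenvectors of more than [k] positive eigenvalues have a nonzero combination killed
    by [N]. Its form is positive, yet its real and imaginary parts both fall under [npN]. *)
Lemma npos_eig_le k (N : 'M[R]_(n, k)) :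
  (forall x, x *m N = 0 -> qform A x <= 0) -> (npos_eig A <= k)%N.
Proof.
move=> npN; have [r [P [uP eqA cA]]] := real_symmetric_spectral symA.
rewrite (npos_eig_prod cA) leqNgt; apply/negP => lt_k.
set pos := [pred i | 0 < r 0 i] in lt_k.
have [u u0 uM] := mul_kernel_nontrivial
  (rowsub (@enum_val _ pos) 1%:M *m P *m toC N) lt_k.
pose y := u *m rowsub (@enum_val _ pos) (1%:M : 'M_n); pose x := y *m P.
have yE j : y 0 (enum_val j) = u 0 j.
  rewrite mxE (bigD1 j) //= !mxE eqxx mulr1 big1 ?addr0 // => l lj.
  by rewrite !mxE (inj_eq enum_val_inj) (negPf lj) mulr0.
have y0 i : ~~ (0 < r 0 i) -> y 0 i = 0.
  move=> ri; rewrite mxE big1 // => l _; rewrite !mxE.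
  case: eqP => [li|]; last by rewrite mulr0.
  by case/negP: ri; rewrite -li; exact: (enum_valP l).
have xN : x *m toC N = 0 by rewrite /x /y -uM !mulmxA.
have : 0 < (x *m toC A *m x^t*) 0 0.
  rewrite eqA /x trmx_mul map_mxM !mulmxA !mulmxtVK // diag_form.
  have [j uj] : exists j, u 0 j != 0.
    by apply/existsP; rewrite -negb_forall; apply: contra u0 => /forallP h;
       apply/eqP/rowP => j; rewrite mxE; apply/eqP.
  have pj : 0 < r 0 (enum_val j) := enum_valP j.
  rewrite (bigD1 (enum_val j)) //= yE ltr_wpDr //; last first.
    by rewrite mulr_gt0 ?ltcR // exprn_gt0 // normr_gt0.
  apply: sumr_ge0 => i _; have [ri|ri] := boolP (0 < r 0 i).
    by rewrite mulr_ge0 ?exprn_ge0 // lecR ltW.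
  by rewrite y0 // normr0 expr0n mulr0.
have := mx_toC_ReIm x.
set a := map_mx (@complex.Re R) x; set b := map_mx (@complex.Im R) x => xE.
have /toC_ReIm_inj[aN bN] : toC (a *m N) + 'i%C *: toC (b *m N) = 0.
  by rewrite -xN xE mulmxDl -scalemxAl !map_mxM.
rewrite xE hermitian_form_ReIm // ltcR ltNge.
by rewrite (le_trans (lerD (npN _ aN) (npN _ bN))) ?addr0.
Qed.

End InertiaBounds.

(** * Subspaces given by parametrized coordinates or by linear equations *)

Section LinearForms.
Variables (R : realType) (n : nat) (A : 'M[R]_n).
Hypothesis symA : A^T = A.

Lemma linear_form_sum k (f : 'rV[R]_k -> R) :
  (forall a t u, f (a *: t + u) = a * f t + f u) ->
  forall t, f t = \sum_i t 0 i * f (delta_mx 0 i).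
Proof.
move=> lin_f t; rewrite [t in LHS]row_sum_delta.
have f0 : f 0 = 0 by have := lin_f (-1) 0 0; rewrite scaler0 addr0 mulN1r addNr.
by elim/big_rec2: _ => // i y1 y2 _ <-; rewrite lin_f.
Qed.

Lemma qformE (x : 'rV[R]_n) : qform A x = \sum_i \sum_j x 0 i * A i j * x 0 j.
Proof.
rewrite /qform mxE exchange_big; apply: eq_bigr => j _.
by rewrite !mxE mulr_suml.
Qed.

Lemma npos_eig_ge_param k (f : 'rV[R]_k -> 'I_n -> R) :
  (forall v a t u, f (a *: t + u) v = a * f t v + f u v) ->
  (forall t, t != 0 -> 0 < qform A (\row_v f t v)) -> (k <= npos_eig A)%N.
Proof.
move=> lin_f pos; apply: (npos_eig_ge symA (W := \matrix_(i, v) f (delta_mx 0 i) v)).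
move=> t /pos; suff -> : \row_v f t v = t *m (\matrix_(i, v) f (delta_mx 0 i) v) by [].
apply/rowP => v; rewrite mxE (linear_form_sum (lin_f v) t) mxE.
by apply: eq_bigr => i _; rewrite mxE.
Qed.

Lemma npos_eig_le_forms k (l : 'I_k -> 'rV[R]_n -> R) :
  (forall j a t u, l j (a *: t + u) = a * l j t + l j u) ->
  (forall x, (forall j, l j x = 0) -> qform A x <= 0) -> (npos_eig A <= k)%N.
Proof.
move=> lin_l neg; apply: (npos_eig_le symA (N := \matrix_(v, j) l j (delta_mx 0 v))).
move=> x /rowP xN; apply: neg => j; rewrite (linear_form_sum (lin_l j) x).
have := xN j; rewrite mxE [RHS]mxE => h.
by rewrite -[RHS]h; apply: eq_bigr => i _; rewrite mxE.
Qed.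

End LinearForms.

Lemma sum_sym_offdiag (R : comPzRingType) N (B : nat -> nat -> R) :
  (forall i j, B i j = B j i) -> (forall i, B i i = 0) ->
  \sum_(0 <= i < N) \sum_(0 <= j < N) B i j =
  (\sum_(0 <= j < N) \sum_(0 <= i < j) B i j) *+ 2.
Proof.
move=> symB B0; elim: N => [|N IH]; first by rewrite !big_geq ?mul0rn.
rewrite !(@big_nat_recr _ _ _ N) //= B0 addr0.
rewrite (eq_big_nat _ _ (F2 := fun i => \sum_(0 <= j < N) B i j + B i N)); last first.
  by move=> i _; rewrite big_nat_recr //=.
have -> : \sum_(0 <= j < N) B N j = \sum_(0 <= i < N) B i N.
  by apply: eq_bigr => i _; exact: symB.
by rewrite big_split /= IH; ring.
Qed.

(** * Vectors supported on a list of vertices *)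

Section SupportedForm.
Variables (R : realType) (n : nat) (A : 'M[R]_n) (v0 : 'I_n).
Hypotheses (symA : A^T = A) (diagA : forall v, A v v = 0).

(** Each unordered pair of positions is counted once, so this is half of the quadratic form. *)
Definition list_form (L : seq 'I_n) (F : nat -> R) : R :=
  \sum_(0 <= j < size L) \sum_(0 <= i < j) A (nth v0 L i) (nth v0 L j) * F i * F j.

Lemma qform_list (L : seq 'I_n) (F : nat -> R) : uniq L ->
  qform A (\row_v (if v \in L then F (index v L) else 0)) = list_form L F *+ 2.
Proof.
move=> uL; rewrite qformE.
have sum_L (G : 'I_n -> R) : (forall v, v \notin L -> G v = 0) ->
    \sum_v G v = \sum_(0 <= i < size L) G (nth v0 L i).
  move=> G0; rewrite -(big_nth v0 xpredT) [RHS]big_uniq //= [RHS]big_mkcond /=.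
  by apply: eq_bigr => v _; case: ifPn => // /G0.
rewrite sum_L; last by move=> v vL; rewrite big1 // => w _; rewrite mxE (negPf vL) !mul0r.
under eq_bigr => i _.
  rewrite sum_L; last by move=> v vL; rewrite [X in _ * X]mxE (negPf vL) mulr0.
  over.
pose B i j := A (nth v0 L i) (nth v0 L j) * F i * F j.
rewrite (eq_big_nat _ _ (F2 := fun i => \sum_(0 <= j < size L) B i j)); last first.
  move=> i /andP[_ iL]; apply: eq_big_nat => j /andP[_ jL].
  by rewrite !mxE !mem_nth // !index_uniq // /B -!mulrA mulrCA.
rewrite sum_sym_offdiag // => [i j|i]; last by rewrite /B diagA !mul0r.
by rewrite /B -[A in LHS]symA mxE -!mulrA [F i * _]mulrC.
Qed.

Lemma npos_eig_ge_list k (L : seq 'I_n) (F : 'rV[R]_k -> nat -> R) : uniq L ->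
  (forall i a t u, F (a *: t + u) i = a * F t i + F u i) ->
  (forall t, t != 0 -> 0 < list_form L (F t)) -> (k <= npos_eig A)%N.
Proof.
move=> uL lin_F pos.
apply: (npos_eig_ge_param symA (f := fun t v => if v \in L then F t (index v L) else 0)).
  by move=> v a t u; case: ifP => // _; rewrite mulr0 addr0.
by move=> t t0; rewrite qform_list // pmulrn_lgt0 // pos.
Qed.

Lemma npos_eig_ge2 (L : seq 'I_n) (u v : seq R) : uniq L ->
  (forall p q, (p != 0) || (q != 0) ->
     0 < list_form L (fun i => p * nth 0 u i + q * nth 0 v i)) ->
  (2 <= npos_eig A)%N.
Proof.
move=> uL pos; apply: (npos_eig_ge_list (L := L)
  (F := fun (t : 'rV_2) i => t 0 0 * nth 0 u i + t 0 1 * nth 0 v i)) => //.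
  by move=> i a t w; rewrite !mxE; ring.
move=> t t0; apply: pos; apply: contraNT t0; rewrite negb_or !negbK => /andP[/eqP t0 /eqP t1].
apply/eqP/rowP => i; rewrite mxE; case: i => [[|[|]]] // lt2.
- by rewrite -[RHS]t0; congr (t _ _); apply: val_inj.
- by rewrite -[RHS]t1; congr (t _ _); apply: val_inj.
Qed.

End SupportedForm.

(** * The quadratic form of a signed cycle *)

Section CycleForm.
Variable R : realType.
Implicit Types (y t : nat -> R) (e z : R).

Definition cycle_form e g y : R :=
  \sum_(0 <= i < g.-1) y i * y i.+1 + e * y 0%N * y g.-1.

(** The terms free of [y 0] are the edges from position 1 to 2m+1; those with [y 0] alternate in
    sign and leave only the first edge. *)
Lemma path_form_telescope y m :
  \sum_(0 <= i < m.*2.+1) y i * y i.+1 =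
  \sum_(0 <= j < m) (y j.*2.+1 + y j.*2.+3) * (y j.*2.+2 + (-1) ^+ j * y 0%N)
  + (-1) ^+ m * y 0%N * y m.*2.+1.
Proof.
elim: m => [|m IH]; first by rewrite big_nat1 big_geq // add0r expr0 mul1r.
rewrite doubleS big_nat_recr //= big_nat_recr //= IH [in RHS]big_nat_recr //=.
by rewrite exprS; ring.
Qed.

(** For even [g] the closing edge joins the remainder. For odd [g] the convention turns the last
    edge of a path one step longer into the closing edge. *)
Lemma cycle_form_telescope e g y m : (0 < m)%N ->
  g = m.*2.+2 \/ g = m.*2.+1 /\ y m.*2.+1 = e * y 0%N ->
  cycle_form e g y =
  \sum_(0 <= j < m) (y j.*2.+1 + y j.*2.+3) * (y j.*2.+2 + (-1) ^+ j * y 0%N)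
  + ((-1) ^+ m + (~~ odd g)%:R * e) * y 0%N * y m.*2.+1.
Proof.
move=> m0 [->|[-> yE]]; rewrite /cycle_form /= odd_double /=.
  by rewrite path_form_telescope; ring.
have := path_form_telescope y m; rewrite big_nat_recr //= yE => h.
by rewrite mul0r addr0 -h; ring.
Qed.

(* The vector y with y_0 = z and y_{2j+1} = t_j whose even entries are chosen so
   that the two factors of each product in [path_form_telescope] are equal. *)
Definition tent z t (i : nat) : R :=
  if i is 0%N then z else
  if odd i then t i./2 else t i./2.-1 + t i./2 - (-1) ^+ i./2.-1 * z.

Lemma cycle_form_tent e z t g m : (0 < m)%N ->
  g = m.*2.+2 \/ g = m.*2.+1 /\ t m = e * z ->
  cycle_form e g (tent z t) =
  \sum_(0 <= j < m) (t j + t j.+1) ^+ 2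
  + ((-1) ^+ m + (~~ odd g)%:R * e) * z * t m.
Proof.
have odd_tent j : tent z t j.*2.+1 = t j by rewrite /tent /= odd_double /= uphalf_double.
move=> m0 hg; rewrite (@cycle_form_telescope e g (tent z t) m) //; last by rewrite odd_tent.
rewrite odd_tent; congr (_ + _); apply: eq_bigr => j _.
have := odd_tent j.+1; rewrite doubleS => ->; rewrite odd_tent.
by rewrite /tent /= odd_double /= doubleK subrK expr2.
Qed.

(** If the last entry is 0, the last square becomes the square of the entry before it, and the
    induction goes on with [c] reset to 1. *)
Lemma sum_tent_gt0 t m c : 0 < c -> (exists2 j, (j <= m)%N & t j != 0) ->
  0 < \sum_(0 <= j < m) (t j + t j.+1) ^+ 2 + c * t m ^+ 2.
Proof.
move=> c0; elim: m c c0 => [|m IH] c c0 [j]; rewrite ?leqn0.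
  by move=> /eqP-> t0; rewrite big_geq // add0r mulr_gt0 // lt_neqAle sqr_ge0 eq_sym expf_neq0.
rewrite leq_eqVlt => jm tj; rewrite big_nat_recr //=.
have S0 : 0 <= \sum_(0 <= i < m) (t i + t i.+1) ^+ 2 by apply: sumr_ge0 => i _; exact: sqr_ge0.
have [tm|tm] := eqVneq (t m.+1) 0.
  have {}jm : (j <= m)%N by case/orP: jm tj => [/eqP->|//]; rewrite tm eqxx.
  by have := IH 1 ltr01 (ex_intro2 _ _ j jm tj); rewrite tm addr0 expr0n mulr0 addr0 mul1r.
by rewrite ltr_wpDl ?addr_ge0 ?sqr_ge0 // mulr_gt0 // lt_neqAle sqr_ge0 eq_sym expf_neq0.
Qed.

End CycleForm.

(** * Signed graphs and their shortest cycles *)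

Section SignedAdjacency.
Variables (R : realType) (n : nat) (adj neg : rel 'I_n).
Hypotheses (simpleG : simple_graph adj) (signG : sign_sym adj neg).
Local Notation A := (sadj_mx R adj neg).

Lemma sadj_sym : A^T = A.
Proof.
have [_ symG] := simpleG; apply/matrixP => i j; rewrite !mxE symG.
by case: ifP => // ij; rewrite signG // symG.
Qed.

Lemma sadj_symE u v : A u v = A v u.
Proof. by rewrite -[in LHS]sadj_sym mxE. Qed.

Lemma sadj_diag v : A v v = 0.
Proof. by have [irrG _] := simpleG; rewrite mxE irrG. Qed.

Lemma sadj_nonedge u v : ~~ adj u v -> A u v = 0.
Proof. by move=> uv; rewrite mxE (negPf uv). Qed.

Lemma sadj_sqr u v : adj u v -> A u v * A u v = 1.
Proof. by move=> uv; rewrite mxE uv; case: ifP => _; rewrite ?mulrNN mulr1. Qed.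

End SignedAdjacency.

Section ShortestCycle.
Variables (n : nat) (adj : rel 'I_n) (s : seq 'I_n) (v0 : 'I_n).
Hypotheses (simpleG : simple_graph adj) (short : shortest_cycle adj s).
Local Notation g := (size s).
Local Notation c := (nth v0 s).

Lemma cycle_sorted_close (p : seq 'I_n) : (0 < size p)%N -> sorted adj p ->
  adj (last v0 p) (head v0 p) -> cycle adj p.
Proof. by case: p => //= x p _ xp lx; rewrite rcons_path xp. Qed.

Lemma shortest_le p : (2 < size p)%N -> uniq p -> sorted adj p ->
  adj (last v0 p) (head v0 p) -> (g <= size p)%N.
Proof.
move=> p3 up sp lp; case: short => _; apply; rewrite /is_cycle p3 up /=.
by apply: cycle_sorted_close => //; case: (p) p3.
Qed.

Lemma shortest_uniq : uniq s.
Proof. by case: short => /and3P[]. Qed.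

Lemma shortest_size : (2 < g)%N.
Proof. by case: short => /and3P[]. Qed.

Lemma shortest_sorted : sorted adj s.
Proof.
case: short => /and3P[_ _]; case: (s) => //= x p.
by rewrite rcons_path => /andP[].
Qed.

Lemma shortest_edge i : (i.+1 < g)%N -> adj (c i) (c i.+1).
Proof. by move=> ig; have := shortest_sorted; move/(sortedP v0); apply. Qed.

Lemma shortest_close : adj (c g.-1) (c 0).
Proof.
rewrite nth_last nth0; case: short => /and3P[s3 _]; case: (s) s3 => //= x p _.
by rewrite rcons_path => /andP[].
Qed.

(** A chord closes the arc from i to j to a cycle of length j-i+1, which is at least [g] only for
    the full arc. *)
Lemma shortest_chordless i j : (i < j)%N -> (j < g)%N -> adj (c i) (c j) ->
  j = i.+1 \/ i = 0%N /\ j = g.-1.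
Proof.
move=> ij jg aij; have [->|jN] := eqVneq j i.+1; [by left | right].
pose p := take (j - i).+1 (drop i s).
have sp : size p = (j - i).+1 by rewrite size_take size_drop; case: ltnP; lia.
have np k : (k < (j - i).+1)%N -> nth v0 p k = c (i + k).
  by move=> kp; rewrite nth_take // nth_drop.
suff : (g <= (j - i).+1)%N by lia.
rewrite -sp; apply: shortest_le.
- by rewrite sp; lia.
- by rewrite take_uniq ?drop_uniq ?shortest_uniq.
- by rewrite take_sorted ?drop_sorted ?shortest_sorted.
rewrite -nth_last -nth0 sp !np // addn0 /= subnKC ?(ltnW ij) //.
by have [_ ->] := simpleG.
Qed.

(** A second neighbour at position i closes cycles of lengths i+2 and g-i+2 through [v]; both being
    at least [g] forces g <= 4. *)
Lemma shortest_pendant v i : (4 < g)%N -> v \notin s -> adj v (c 0) ->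
  (0 < i)%N -> (i < g)%N -> ~~ adj v (c i).
Proof.
move=> g4 vs v0s i0 ig; apply/negP => vi.
have [_ symG] := simpleG.
have h1 : (g <= i.+2)%N.
  have sp : size (v :: take i.+1 s) = i.+2 by rewrite /= size_take; case: ltnP; lia.
  rewrite -sp; apply: shortest_le.
  - by rewrite sp; lia.
  - rewrite /= take_uniq ?shortest_uniq // andbT.
    by apply: contra vs => /mem_take.
  - have := take_sorted i.+1 shortest_sorted.
    by move: v0s; case: (s) => //= x p -> ->.
  - rewrite -nth_last -[head _ _]/v sp /= nth_take //.
    by rewrite symG.
suff : (g <= (g - i).+2)%N by lia.
have sp : size (v :: rcons (drop i s) (c 0)) = (g - i).+2 by rewrite /= size_rcons size_drop.
rewrite -sp; apply: shortest_le.
- by rewrite sp; lia.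
- rewrite /= mem_rcons inE negb_or rcons_uniq drop_uniq ?shortest_uniq // andbT -!andbA.
  apply/and3P; split.
  + by apply: contra vs => /eqP->; rewrite mem_nth // (leq_trans _ ig).
  + by apply: contra vs => /mem_drop.
  + apply/negP => /(nthP v0)[k]; rewrite size_drop nth_drop => kg /eqP.
    by rewrite nth_uniq ?shortest_uniq; lia.
- have : adj v (head v0 (drop i s)) by rewrite -nth0 nth_drop addn0.
  have := drop_sorted i shortest_sorted.
  have : last v0 (drop i s) = c g.-1.
    by rewrite -nth_last size_drop nth_drop; congr nth; lia.
  have : (0 < size (drop i s))%N by rewrite size_drop; lia.
  case: (drop i s) => //= x p _ lp xp ->.
  by rewrite rcons_path xp lp shortest_close.
- by rewrite /= last_rcons symG.
Qed.

End ShortestCycle.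

(** * Switching along a shortest cycle *)

Section CycleWeights.
Variables (R : realType) (n : nat) (adj neg : rel 'I_n) (s : seq 'I_n) (v0 : 'I_n).
Hypotheses (simpleG : simple_graph adj) (signG : sign_sym adj neg).
Hypothesis (short : shortest_cycle adj s).
Local Notation A := (sadj_mx R adj neg).
Local Notation g := (size s).
Local Notation c := (nth v0 s).

(* Rescaling vertex i of the cycle by [path_sign i] is the switching that makes
   its first g - 1 edges positive. *)
Definition path_sign i : R := \prod_(0 <= j < i) A (c j) (c j.+1).
Definition cycle_sign : R := path_sign g.-1 * A (c g.-1) (c 0).

Lemma path_sign_sqr i : (i < g)%N -> path_sign i * path_sign i = 1.
Proof.
elim: i => [|i IH] ig; first by rewrite /path_sign big_geq // mulr1.
rewrite /path_sign big_nat_recr //= mulrACA IH 1?ltnW // mul1r sadj_sqr //.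
exact: (shortest_edge _ short).
Qed.

Lemma cycle_sign_sqr : cycle_sign * cycle_sign = 1.
Proof.
have g3 := shortest_size short.
rewrite /cycle_sign mulrACA path_sign_sqr; last by lia.
by rewrite mul1r sadj_sqr // (shortest_close _ short).
Qed.

(** Without chords only consecutive pairs and the closing pair contribute, and the weights
    [path_sign] cancel every sign but that of the closing edge. *)
Lemma list_form_cycle (y : nat -> R) :
  list_form A v0 s (fun i => path_sign i * y i) = cycle_form cycle_sign g y.
Proof.
have g3 := shortest_size short.
pose B i j := A (c i) (c j) * (path_sign i * y i) * (path_sign j * y j).
have B0 i j : (i < j)%N -> (j < g)%N -> j != i.+1 ->
    ~~ ((i == 0%N) && (j == g.-1)) -> B i j = 0.
  move=> ij jg jN ij0; rewrite /B sadj_nonedge ?mul0r //.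
  apply/negP => /(shortest_chordless simpleG short ij jg).
  by case => [/eqP|[/eqP i0 /eqP j0]]; [apply/negP | rewrite i0 j0 in ij0].
have BS i : (i.+1 < g)%N -> B i i.+1 = y i * y i.+1.
  move=> ig; rewrite /B /path_sign big_nat_recr //= -/(path_sign i).
  have := path_sign_sqr (ltnW ig); have := sadj_sqr R neg (shortest_edge v0 short ig).
  set a := A _ _; set p := path_sign i => aa pp.
  have -> : a * (p * y i) * (p * a * y i.+1) = (a * a) * (p * p) * (y i * y i.+1) by ring.
  by rewrite aa pp !mul1r.
have [N gE] : {N | g = N.+3} by exists (g - 3)%N; lia.
have B0N : B 0%N N.+2 = cycle_sign * y 0%N * y N.+2.
  rewrite /B /cycle_sign gE /= (sadj_symE R simpleG signG) /path_sign big_geq //.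
  by ring.
rewrite /list_form (eq_bigr (fun j => \sum_(0 <= i < j) B i j)) // gE.
(* The last position has two earlier neighbours, the first position and its predecessor; every other
   one has only its predecessor. *)
have S_last : \sum_(0 <= i < N.+2) B i N.+2 = B 0%N N.+2 + B N.+1 N.+2.
  rewrite big_ltn // big_nat_recr //= big_nat big1 ?add0r // => i /andP[i0 iN].
  by rewrite B0 //; lia.
have S_mid j : (j < N.+1)%N -> \sum_(0 <= i < j.+1) B i j.+1 = B j j.+1.
  move=> jN; rewrite big_nat_recr //= big_nat big1 ?add0r // => i /andP[_ ij].
  by rewrite B0 //; lia.
rewrite big_nat_recl // [X in X + _]big_geq // add0r big_nat_recr //= S_last B0N BS ?gE //.
rewrite /cycle_form /= [in RHS]big_nat_recr //= addrA addrAC; congr (_ + _ + _).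
by apply: eq_big_nat => i /andP[_ iN]; rewrite S_mid // BS //; lia.
Qed.

Lemma list_form_rcons (L : seq 'I_n) v (F : nat -> R) :
  list_form A v0 (rcons L v) F = list_form A v0 L F +
   \sum_(0 <= i < size L) A (nth v0 L i) v * F i * F (size L).
Proof.
rewrite /list_form size_rcons big_nat_recr //=; congr (_ + _).
  apply: eq_big_nat => j /andP[_ jL]; apply: eq_big_nat => i /andP[_ ij].
  by rewrite !nth_rcons jL (ltn_trans ij jL).
by apply: eq_big_nat => i /andP[_ iL]; rewrite !nth_rcons iL ltnn eqxx.
Qed.

End CycleWeights.

Section RowExtension.
Variables (R : realType) (k : nat).
Implicit Types t u : 'rV[R]_k.

(** Zero past the end supplies the boundary value t_m = 0 when [k] is m. *)
Definition row_ext t (j : nat) : R := oapp (fun i : 'I_k => t 0 i) 0 (insub j).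

Lemma row_ext_linear a t u j : row_ext (a *: t + u) j = a * row_ext t j + row_ext u j.
Proof. by rewrite /row_ext; case: insub => [i|] /=; rewrite ?mxE // mulr0 addr0. Qed.

Lemma row_ext_out t j : (k <= j)%N -> row_ext t j = 0.
Proof. by move=> kj; rewrite /row_ext insubF // ltnNge kj. Qed.

Lemma row_ext_neq0 t : t != 0 -> exists2 j, (j < k)%N & row_ext t j != 0.
Proof.
move=> t0; have /existsP[i ti] : [exists i, t 0 i != 0].
  rewrite -negb_forall; apply: contra t0 => /forallP h.
  by apply/eqP/rowP => i; rewrite mxE; apply/eqP.
by exists i => //; rewrite /row_ext valK.
Qed.

Lemma tent_linear a z1 z2 (t1 t2 t3 : nat -> R) i :
  (forall j, t3 j = a * t1 j + t2 j) ->
  tent (a * z1 + z2) t3 i = a * tent z1 t1 i + tent z2 t2 i.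
Proof.
move=> h; rewrite /tent; case: i => // i; case: ifP => _; rewrite !h //.
by ring.
Qed.

End RowExtension.

(** * Inertia bounds from a shortest cycle *)

Section CycleBounds.
Variables (R : realType) (n : nat) (adj neg : rel 'I_n) (s : seq 'I_n) (v0 : 'I_n).
Hypotheses (simpleG : simple_graph adj) (signG : sign_sym adj neg).
Hypothesis (short : shortest_cycle adj s).
Variable m : nat.
Hypothesis (gm : size s = m.*2.+2 \/ size s = m.*2.+1).
Local Notation A := (sadj_mx R adj neg).
Local Notation g := (size s).
Local Notation c := (nth v0 s).
Local Notation e := (cycle_sign R adj neg s v0).
Local Notation sgn := (path_sign R adj neg s v0).

Let symA : A^T = A := sadj_sym R simpleG signG.
Let diagA : forall v, A v v = 0 := sadj_diag R neg simpleG.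

Lemma half_girth_gt0 : (0 < m)%N.
Proof. by have := shortest_size short; lia. Qed.

(** Tents with y_0 = t_m = 0 have no remainder term, and their sum of squares is positive definite
    in the m free parameters. *)
Lemma cycle_ipos_ge : (m <= npos_eig A)%N.
Proof.
have m0 := half_girth_gt0.
apply: (npos_eig_ge_list (v0 := v0) symA diagA (L := s)
  (F := fun (t : 'rV_m) i => sgn i * tent 0 (row_ext t) i)).
- exact: shortest_uniq short.
- move=> i a t u; have := tent_linear 0 0 i (row_ext_linear a t u).
  by rewrite mulr0 addr0 => ->; ring.
move=> t /row_ext_neq0[j jm tj]; rewrite list_form_cycle //.
have tm : row_ext t m = 0 by rewrite row_ext_out.
rewrite (cycle_form_tent (m := m)) //; last by case: gm; [left | right]; rewrite ?mulr0.
have := sum_tent_gt0 ltr01 (ex_intro2 _ _ j (ltnW jm) tj).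
by rewrite tm mulr0 expr0n mulr0.
Qed.

(** Now t_m is free as well. Since e^2 = 1, the choice y_0 = e t_m meets the odd convention and
    makes the remainder a positive multiple of t_m^2. *)
Lemma cycle_ipos_gt : (-1) ^+ m = e -> (m < npos_eig A)%N.
Proof.
move=> em; have m0 := half_girth_gt0.
have ee : e * e = 1 by apply: cycle_sign_sqr.
apply: (npos_eig_ge_list (v0 := v0) symA diagA (L := s)
  (F := fun (t : 'rV_m.+1) i => sgn i * tent (e * row_ext t m) (row_ext t) i)).
- exact: shortest_uniq short.
- move=> i a t u.
  have := tent_linear (e * row_ext t m) (e * row_ext u m) i (row_ext_linear a t u).
  by rewrite row_ext_linear mulrDr mulrCA => ->; ring.
move=> t /row_ext_neq0[j jm tj]; rewrite list_form_cycle //.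
rewrite (cycle_form_tent (m := m)) //; last first.
  by case: gm; [left | right]; rewrite // mulrA ee mul1r.
have c0 : 0 < 1 + (~~ odd g)%:R :> R by rewrite ltr_wpDr.
have := sum_tent_gt0 c0 (ex_intro2 _ _ j jm tj); congr (_ < _ + _).
rewrite em; set b := _%:R; set x := row_ext t m.
have -> : (e + b * e) * (e * x) * x = (1 + b) * (e * e) * x ^+ 2 by ring.
by rewrite ee mulr1.
Qed.

(** The m linear conditions make the two factors of each product opposite, hence each product minus
    a square; the remainder is 0 for even [g] and -y_0^2 for odd [g]. *)
Lemma cycle_ipos_le : (forall v, v \in s) -> (-1) ^+ m = - e -> (npos_eig A <= m)%N.
Proof.
move=> all_s em; have m0 := half_girth_gt0.
have ee : e * e = 1 by apply: cycle_sign_sqr.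
(* For odd [g] the index 2m+1 equals [g], just past the cycle, and gets the conventional value; for
   even [g] all indices used stay below [g]. *)
pose y (x : 'rV[R]_n) i := if (i < g)%N then sgn i * x 0 (c i) else e * x 0 (c 0%N).
have lin_y a t u i : y (a *: t + u) i = a * y t i + y u i.
  by rewrite /y; case: ifP => _; rewrite !mxE; ring.
apply: (npos_eig_le_forms symA (l := fun (j : 'I_m) x =>
  (y x j.*2.+1 + y x j.*2.+3) + (y x j.*2.+2 + (-1) ^+ j * y x 0%N))).
  by move=> j a t u; rewrite !lin_y; ring.
move=> x xl.
have xE : x = \row_v (if v \in s then x 0 (c (index v s)) else 0).
  by apply/rowP => v; rewrite mxE all_s nth_index.
rewrite xE (@qform_list R n A v0 symA diagA s (fun i => x 0 (c i)) (shortest_uniq short)).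
have sgn_y i : (i < g)%N -> sgn i * y x i = x 0 (c i).
  by move=> ig; rewrite /y ig mulrA path_sign_sqr // mul1r.
have -> : list_form A v0 s (fun i => x 0 (c i)) = list_form A v0 s (fun i => sgn i * y x i).
  apply: eq_big_nat => j /andP[_ jg]; apply: eq_big_nat => i /andP[_ ij].
  by rewrite !sgn_y // (ltn_trans ij jg).
rewrite list_form_cycle // pmulrn_lle0 //.
have g0 : (0 < g)%N by have := shortest_size short; lia.
have sgn0 : sgn 0%N = 1 by rewrite /path_sign big_geq.
rewrite (cycle_form_telescope (m := m)) //; last first.
  by case: gm => gE; [left | right]; rewrite // /y g0 gE ltnn sgn0 mul1r.
rewrite -[X in _ <= X]addr0 lerD //.
  rewrite big_nat; apply: sumr_le0 => j /andP[_ jm].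
  have /= /eqP := xl (Ordinal jm); rewrite addr_eq0 => /eqP ->.
  by rewrite mulNr oppr_le0 -expr2 sqr_ge0.
rewrite em; case: gm => gE.
  have -> : odd g = false by rewrite gE /= odd_double.
  by rewrite mul1r addNr !mul0r.
have -> : odd g by rewrite gE /= odd_double.
have -> : y x m.*2.+1 = e * y x 0%N by rewrite /y g0 gE ltnn sgn0 mul1r.
have -> : (- e + 0%:R * e) * y x 0%N * (e * y x 0%N) = - (e * e) * (y x 0%N) ^+ 2 by ring.
by rewrite ee mulN1r oppr_le0 sqr_ge0.
Qed.

(** The tents with y_0 = 0 already span m dimensions. A free value at position 0 adds one more,
    because the entry at [v], adjacent to that position only, can absorb the mixed terms. *)
Lemma pendant_ipos_gt v : (4 < g)%N -> v \notin s -> adj v (c 0) -> (m < npos_eig A)%N.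
Proof.
move=> g4 vs vc0; have m0 := half_girth_gt0.
(* The first m parameters shape the tent; the last one is reserved for the value at position 0. *)
pose trunc (t : 'rV[R]_m.+1) j := if (j < m)%N then row_ext t j else 0.
have lin_tr a t u j : trunc (a *: t + u) j = a * trunc t j + trunc u j.
  by rewrite /trunc; case: ifP => _; rewrite ?row_ext_linear // mulr0 addr0.
pose w t i := tent 0 (trunc t) i.
have lin_w a t u i : w (a *: t + u) i = a * w t i + w u i.
  by have := tent_linear 0 0 i (lin_tr a t u); rewrite mulr0 addr0.
pose y t i := if i is 0%N then row_ext t m else w t i.
have lin_y a t u i : y (a *: t + u) i = a * y t i + y u i.
  by case: i => [|i]; rewrite /y ?row_ext_linear ?lin_w.
(* The entry at v completes the square: all terms involving y_0 sum to y_0 ^ 2. *)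
pose top t := A (c 0%N) v * (row_ext t m - w t 1%N - e * w t g.-1).
apply: (npos_eig_ge_list (v0 := v0) symA diagA (L := rcons s v)
  (F := fun t i => if (i < g)%N then sgn i * y t i else top t)).
- by rewrite rcons_uniq vs (shortest_uniq short).
- move=> i a t u; case: ifP => _; first by rewrite lin_y; ring.
  by rewrite /top row_ext_linear !lin_w; ring.
move=> t /row_ext_neq0[j jm tj].
rewrite list_form_rcons ltnn.
have -> : list_form A v0 s (fun i => if (i < g)%N then sgn i * y t i else top t) =
    cycle_form e g (y t).
  rewrite -list_form_cycle //; apply: eq_big_nat => k /andP[_ kg].
  by apply: eq_big_nat => i /andP[_ ik]; rewrite kg (ltn_trans ik kg).
have [N gE] : {N | g = N.+3} by exists (g - 3)%N; lia.
have sgn0 : sgn 0%N = 1 by rewrite /path_sign big_geq.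
have vc0' : adj (c 0%N) v by have [_ ->] := simpleG.
have -> : \sum_(0 <= i < g) A (c i) v * (if (i < g)%N then sgn i * y t i else top t) * top t
   = row_ext t m * (row_ext t m - w t 1%N - e * w t g.-1).
  rewrite big_ltn; last by rewrite gE.
  rewrite big_nat big1 ?addr0 => [|i /andP[i0 ig]]; last first.
    by rewrite (sadj_symE R simpleG signG) sadj_nonedge ?mul0r //
      (shortest_pendant (v0 := v0) simpleG short).
  rewrite {1}gE /= sgn0 mul1r /top.
  set a := A _ _; set r := row_ext t m; set q := _ - _.
  have -> : a * r * (a * q) = (a * a) * (r * q) by ring.
  by rewrite sadj_sqr // mul1r.
have -> : cycle_form e g (y t) =
    cycle_form e g (w t) + row_ext t m * w t 1%N + e * row_ext t m * w t g.-1.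
  have yS i : y t i.+1 = w t i.+1 by [].
  have y0 : y t 0%N = row_ext t m by [].
  have w0 : w t 0%N = 0 by [].
  rewrite /cycle_form gE -[N.+3.-1]/N.+2 !(@big_nat_recl _ _ _ N.+1) // w0 y0 !yS.
  by rewrite (eq_bigr (fun i => w t i.+1 * w t i.+2)) //; ring.
have tm : trunc t m = 0 by rewrite /trunc ltnn.
rewrite (cycle_form_tent (m := m)) //; last by case: gm; [left | right]; rewrite ?tm ?mulr0.
rewrite mulr0 mul0r addr0; set S := \sum_(_ <= _ < _) _.
set r := row_ext t m.
have -> : S + r * w t 1%N + e * r * w t g.-1 + r * (r - w t 1%N - e * w t g.-1) =
    S + r ^+ 2 by ring.
have S0 : 0 <= S by apply: sumr_ge0 => i _; exact: sqr_ge0.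
have [r0|r0] := eqVneq r 0; last first.
  by rewrite ltr_wpDl // lt_neqAle sqr_ge0 eq_sym expf_neq0.
have jm' : (j < m)%N.
  by move: jm; rewrite ltnS leq_eqVlt => /orP[/eqP jE|//]; move: tj; rewrite jE -/r r0 eqxx.
have tj' : trunc t j != 0 by rewrite /trunc jm'.
have := sum_tent_gt0 ltr01 (ex_intro2 _ _ j (ltnW jm') tj').
by rewrite tm r0 expr0n mulr0.
Qed.

End CycleBounds.

(** * Graphs with one positive eigenvalue *)

Section OnePositiveEigenvalue.
Variables (R : realType) (n : nat) (adj neg : rel 'I_n).
Hypotheses (simpleG : simple_graph adj) (signG : sign_sym adj neg).
Local Notation A := (sadj_mx R adj neg).

Let symA : A^T = A := sadj_sym R simpleG signG.
Let diagA : forall v, A v v = 0 := sadj_diag R neg simpleG.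

Lemma adj_neq x y : adj x y -> x != y.
Proof. by have [irrG _] := simpleG; apply: contraTneq => ->; rewrite irrG. Qed.

Lemma two_squares_gt0 (p q : R) : (p != 0) || (q != 0) -> 0 < p ^+ 2 + q ^+ 2.
Proof.
move=> pq; rewrite lt_neqAle addr_ge0 ?sqr_ge0 // andbT eq_sym.
by rewrite paddr_eq0 ?sqr_ge0 // !expf_eq0 negb_and.
Qed.

(** Each of the two edges gives a positive vector; as [z] sees neither [x] nor [y], its entry can be
    tuned against the edges from [w] to [x] and [y]. *)
Lemma edge_apart_ipos_ge2 z w x y : adj z w -> adj x y -> ~~ adj z x -> ~~ adj z y ->
  (2 <= npos_eig A)%N.
Proof.
move=> zw xy zx zy; have [irrG symG] := simpleG.
pose s := A z w; pose t := A x y.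
have ss : s * s = 1 by apply: sadj_sqr.
have tt : t * t = 1 by apply: sadj_sqr.
(* The entry - s * b at z makes the two vectors orthogonal for the form. *)
pose b := A w x + A w y * t.
apply: (npos_eig_ge2 (v0 := z) symA diagA (L := [:: z; w; x; y]) (u := [:: s; 1; 0; 0])
   (v := [:: - s * b; 0; 1; t])).
  have zNx : z != x by apply: contraNneq zy => ->.
  have zNy : z != y by apply: contraNneq zx => ->; rewrite symG.
  have wNx : w != x by apply: contraNneq zx => <-.
  have wNy : w != y by apply: contraNneq zy => <-.
  by rewrite /= !inE !negb_or (adj_neq zw) (adj_neq xy) zNx zNy wNx wNy.
move=> p q /two_squares_gt0; congr (_ < _).
rewrite /list_form /= !big_nat_recr //= !big_geq //=.
rewrite (sadj_nonedge R neg zx) (sadj_nonedge R neg zy) -/s -/t.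
have -> : p ^+ 2 + q ^+ 2 =
    (s * s) * p ^+ 2 - (s * s) * b * p * q + b * p * q + (t * t) * q ^+ 2.
  by rewrite ss tt; ring.
by rewrite /b; ring.
Qed.

Lemma unbalanced_triangle_ipos_ge2 x y z : adj x y -> adj y z -> adj x z ->
  A x y * A y z * A x z = -1 -> (2 <= npos_eig A)%N.
Proof.
move=> xy yz xz abc.
(* Up to switching the triangle is - K_3, and the vectors are e_1 - e_2, e_2 - e_3. *)
apply: (npos_eig_ge2 (v0 := x) symA diagA (L := [:: x; y; z])
   (u := [:: 1; A x y; 0]) (v := [:: 0; - A x y; A x z])).
  by rewrite /= !inE !negb_or (adj_neq xy) (adj_neq xz) (adj_neq yz).
move=> p q pq; rewrite /list_form /= !big_nat_recr //= !big_geq //=.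
have := sadj_sqr R neg xy; have := sadj_sqr R neg xz.
move: abc; set a := A x y; set b := A y z; set c := A x z => abc cc aa.
set S := (X in _ < X).
have -> : S = (a * a) * (p * p) - (a * a) * (p * q) + (c * c) * (p * q)
    + (a * b * c) * (p * q - q * q) by rewrite /S; ring.
rewrite aa cc abc.
(* The form is now p^2 - pq + q^2, half of p^2 + q^2 + (p - q)^2. *)
have := two_squares_gt0 pq; have := sqr_ge0 (p - q); nra.
Qed.

(** The two vectors are signed stars at [x] and at [z]. Imbalance gives ab + cd = 0, which kills the
    mixed term and leaves 2p^2 + 2q^2. *)
Lemma unbalanced_square_ipos_ge2 x y z w : adj x y -> adj y z -> adj z w -> adj x w ->
  ~~ adj x z -> ~~ adj y w -> A x y * A y z * A z w * A x w = -1 -> (2 <= npos_eig A)%N.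
Proof.
move=> xy yz zw xw xz yw abcd; have [irrG symG] := simpleG.
(* Opposite corners might coincide, but then the edges pair up and the product of signs is 1. *)
have [xNz|xz_eq] := boolP (x != z); last first.
  move: abcd; rewrite -(eqP (negPn xz_eq)) [A y x](sadj_symE R simpleG signG).
  by rewrite sadj_sqr // mul1r sadj_sqr // => h; have := @ltr01 R; lra.
have [yNw|yw_eq] := boolP (y != w); last first.
  move: abcd; rewrite -(eqP (negPn yw_eq)) [A z y](sadj_symE R simpleG signG).
  have -> : A x y * A y z * A y z * A x y = (A x y * A x y) * (A y z * A y z) by ring.
  by rewrite !sadj_sqr // mul1r => h; have := @ltr01 R; lra.
pose a := A x y; pose b := A y z; pose c := A z w; pose d := A x w.
apply: (npos_eig_ge2 (v0 := x) symA diagA (L := [:: x; y; z; w])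
   (u := [:: 1; a; 0; d]) (v := [:: 0; b; 1; c])).
  by rewrite /= !inE !negb_or (adj_neq xy) (adj_neq xw) (adj_neq yz) (adj_neq zw) xNz yNw.
move=> p q pq; rewrite /list_form /= !big_nat_recr //= !big_geq //=.
rewrite (sadj_nonedge R neg xz) (sadj_nonedge R neg yw) -/a -/b -/c -/d.
have := sadj_sqr R neg xy; have := sadj_sqr R neg yz; have := sadj_sqr R neg zw.
have := sadj_sqr R neg xw; rewrite -/a -/b -/c -/d => dd cc bb aa.
have ab : a * b = - (c * d).
  have -> : a * b = (a * b) * ((c * c) * (d * d)) by rewrite cc dd !mulr1.
  have -> : (a * b) * ((c * c) * (d * d)) = (a * b * c * d) * (c * d) by ring.
  by rewrite abcd mulN1r.
set S := (X in _ < X).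
have -> : S = (a * a + d * d) * p ^+ 2 + (b * b + c * c) * q ^+ 2
    + (a * b + c * d) * (p * q) *+ 2.
  by rewrite /S; ring.
rewrite ab aa bb cc dd; have := two_squares_gt0 pq; lra.
Qed.

End OnePositiveEigenvalue.

(** * Recognizing complete multipartite graphs *)

Section CompleteMultipartite.
Variables (R : realType) (n : nat) (adj neg : rel 'I_n).
Hypotheses (simpleG : simple_graph adj) (signG : sign_sym adj neg).
Local Notation A := (sadj_mx R adj neg).

Lemma sadj_edge u v : adj u v -> A u v = (-1) ^+ neg u v.
Proof. by move=> uv; rewrite mxE uv; case: (neg u v). Qed.

Lemma connected_neighbor u z : connected_graph adj -> z != u -> exists w, adj z w.
Proof.
move=> con zu; have /connectP[[|w p] /= ] := con z u.
  by move=> _ uz; rewrite uz eqxx in zu.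
by case/andP=> zw _ _; exists w.
Qed.

Lemma one_positive_multipartite r w : connected_graph adj -> adj r w ->
  (npos_eig A < 2)%N -> switch_complete_multipartite adj neg.
Proof.
move=> con rw; rewrite ltnNge => /negP lt2; have [irrG symG] := simpleG.
have apart x y z : adj x y -> adj z x || adj z y.
  move=> xy; apply/negPn/negP; rewrite negb_or => /andP[zx zy].
  have [t zt] : exists t, adj z t.
    by apply: (@connected_neighbor x) => //; apply: contraNneq zy => ->.
  by apply: lt2; apply: edge_apart_ipos_ge2 zt xy zx zy.
have triangle x y z : adj x y -> adj y z -> adj x z ->
    neg x y (+) neg y z (+) neg x z = false.
  move=> xy yz xz; apply/negP => h; apply: lt2.
  apply: (unbalanced_triangle_ipos_ge2 simpleG signG xy yz xz).
  by rewrite !sadj_edge // -!signr_addb h.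
have square x y z t : adj x y -> adj y z -> adj z t -> adj x t -> ~~ adj x z -> ~~ adj y t ->
    neg x y (+) neg y z (+) neg z t (+) neg x t = false.
  move=> xy yz zt xt xz yt; apply/negP => h; apply: lt2.
  apply: (unbalanced_square_ipos_ge2 simpleG signG xy yz zt xt xz yt).
  by rewrite !sadj_edge // -!signr_addb h.
(* Non-adjacency will be an equivalence; [rep x] is a canonical member of the class of [x]. *)
pose rep x := odflt x [pick y | ~~ adj x y].
have rep_adj x : ~~ adj x (rep x).
  by rewrite /rep; case: pickP => [y //|/(_ x)]; rewrite irrG.
have repE x y : (rep x == rep y) = ~~ adj x y.
  apply/idP/idP => [/eqP xy|xy].
    apply/negP => /(apart _ _ (rep x)); rewrite [adj _ x]symG (negPf (rep_adj x)) /=.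
    by rewrite xy symG (negPf (rep_adj y)).
  have same z : adj x z = adj y z.
    apply/idP/idP => [xz|yz].
      by have := apart _ _ y xz; rewrite symG (negPf xy).
    by have := apart _ _ x yz; rewrite (negPf xy).
  rewrite /rep (eq_pick (Q := fun z => ~~ adj y z)); last by move=> z /=; rewrite same.
  by case: pickP => [//|/(_ y)]; rewrite irrG.
pose I := [set rep x | x in 'I_n].
have repI x : rep x \in I by apply: imset_f.
pose part x := enum_rank_in (repI r) (rep x).
have partE x y : (part x == part y) = ~~ adj x y.
  rewrite -repE; apply/eqP/eqP => [|xy]; last by rewrite /part xy.
  exact: (enum_rank_in_inj (repI x) (repI y)).
(* The sign of a path from [r]: the edge itself for neighbours of [r], and the path through [w] for
   the class of [r]. *)
pose theta x := if adj r x then neg r x else neg x w (+) neg w r.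
(* Here [y] lies in the class of [r], so it is adjacent to [w]. If [x] is adjacent to [w], two
   triangles share the edge xw; if [x] is another vertex of the class of [w], then r, x, y, w is an
   induced square. *)
have theta_half x y : adj x y -> adj r x -> ~~ adj r y ->
    theta x (+) neg x y (+) theta y = false.
  move=> xy rx ry; rewrite /theta rx (negPf ry).
  have yw : adj y w by have := apart _ _ y rw; rewrite symG (negPf ry).
  have [xw|xNw] := eqVneq x w.
    by rewrite xw [neg y w]signG // [neg r w]signG //; case: (neg w r); case: (neg w y).
  have [xw|xw] := boolP (adj x w).
    have := triangle _ _ _ rx xw rw; have := triangle _ _ _ xy yw xw.
    rewrite [neg w r]signG ?[adj w r]symG //.
    by case: (neg r x); case: (neg x w); case: (neg r w); case: (neg x y); case: (neg y w).
  have := square _ _ _ _ rx xy yw rw ry xw; rewrite [neg w r]signG ?[adj w r]symG //.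
  by case: (neg r x); case: (neg r w); case: (neg x y); case: (neg y w).
exists #|I|, part, theta; split.
- apply: (@leq_trans #|[set part r; part w]|); first by rewrite cards2 partE rw.
  by rewrite -[X in (_ <= X)%N]card_ord max_card.
- move=> k; have /imsetP[x _ kx] := enum_valP k.
  by exists x; rewrite /part -kx enum_valK_in.
- by move=> x y; rewrite partE negbK.
(* Two neighbours of [r] form a triangle with it; two vertices of its class cannot be adjacent, by
   [apart]. *)
move=> x y xy; have [rx|rx] := boolP (adj r x); have [ry|ry] := boolP (adj r y).
- by rewrite /theta rx ry; apply: triangle.
- exact: theta_half.
- rewrite [neg x y]signG // addbC addbA addbAC; apply: theta_half => //; by rewrite symG.
- by have := apart _ _ r xy; rewrite (negPf rx) (negPf ry).
Qed.

(** After switching, the form is the square of the total sum minus the squares of the sums over the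
    parts. *)
Lemma multipartite_ipos_le1 : switch_complete_multipartite adj neg -> (npos_eig A <= 1)%N.
Proof.
case=> l [part [theta [_ _ adjE thetaE]]].
pose y (x : 'rV[R]_n) v := (-1) ^+ theta v * x 0 v.
have symA : A^T = A := sadj_sym R simpleG signG.
apply: (npos_eig_le_forms symA (l := fun _ x => \sum_v y x v)).
  move=> _ a t u; rewrite mulr_sumr -big_split /=; apply: eq_bigr => v _.
  by rewrite /y !mxE; ring.
move=> x /(_ ord0) sum0.
rewrite qformE.
have -> : \sum_i \sum_j x 0 i * A i j * x 0 j =
    (\sum_i y x i) ^+ 2 - \sum_(k < l) (\sum_(i | part i == k) y x i) ^+ 2.
  have -> : \sum_(k < l) (\sum_(i | part i == k) y x i) ^+ 2 =
      \sum_i \sum_(j | part j == part i) y x i * y x j.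
    rewrite (partition_big part xpredT) //=; apply: eq_bigr => k _.
    rewrite expr2 mulr_suml; apply: eq_bigr => i /eqP ik.
    by rewrite mulr_sumr ik.
  rewrite expr2 mulr_suml -sumrB; apply: eq_bigr => i _.
  rewrite mulr_sumr [X in _ - X]big_mkcond -sumrB; apply: eq_bigr => j _.
  rewrite eq_sym; have := thetaE i j; rewrite mxE adjE; case: eqP => _ /=.
    by rewrite mulr0 mul0r subrr.
  move=> /(_ isT); rewrite /y subr0.
  by case: (theta i); case: (neg i j); case: (theta j) => //= _; rewrite ?expr0 ?expr1; ring.
by rewrite sum0 expr0n sub0r oppr_le0 sumr_ge0 // => k _; exact: sqr_ge0.
Qed.

End CompleteMultipartite.

(** * Edges and sign of the cycle in terms of [next] *)

Section CycleStructure.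
Variables (n : nat) (adj neg : rel 'I_n) (s : seq 'I_n) (v0 : 'I_n).
Hypotheses (simpleG : simple_graph adj) (signG : sign_sym adj neg).
Hypothesis (short : shortest_cycle adj s).
Local Notation g := (size s).
Local Notation c := (nth v0 s).

Lemma next_cycle i : (i < g)%N -> next s (c i) = c (if (i.+1 < g)%N then i.+1 else 0%N).
Proof.
move=> ig; rewrite next_nth mem_nth //; have us := shortest_uniq short.
case: (s) us ig => // x p us ig.
rewrite index_uniq //=; case: ltnP => ip /=; first exact: set_nth_default.
by rewrite nth_default.
Qed.

Lemma spanning_shortest_cycle : (forall v : 'I_n, v \in s) -> graph_is_cycle adj s.
Proof.
move=> all_s; split=> // x y; have [irrG symG] := simpleG.
have us := shortest_uniq short; have g3 := shortest_size short.
have nextE (u v : 'I_n) : next s u == v -> adj u v.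
  move/eqP <-; have /(nthP v0)[i ig <-] := all_s u.
  rewrite next_cycle //; case: ltnP => ig'; first exact: (shortest_edge v0 short).
  have -> : i = g.-1 by (move: (ig : (i < g)%N) (ig' : (g <= i.+1)%N); clear; lia).
  exact: (shortest_close v0 short).
have adjE i j : (i < j)%N -> (j < g)%N -> adj (c i) (c j) ->
    (next s (c i) == c j) || (next s (c j) == c i).
  move=> ij jg /(shortest_chordless simpleG short ij jg)[jE|[i0 jE]].
    by rewrite next_cycle -?jE ?jg ?eqxx //; lia.
  rewrite [next s (c j)]next_cycle //; case: ltnP; first by lia.
  by rewrite i0 eqxx orbT.
rewrite /cycle_edge all_s /=.
have -> : (prev s x == y) = (next s y == x).
  by apply/eqP/eqP => <-; rewrite ?next_prev ?prev_next.
apply/idP/idP => [|/orP[/nextE //|/nextE]]; last by rewrite symG.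
have /(nthP v0)[i ig <-] := all_s x; have /(nthP v0)[j jg <-] := all_s y.
case: (ltngtP i j) => [ij|ji|->]; last by rewrite irrG.
- exact: adjE.
- by rewrite symG orbC; apply: adjE.
Qed.

(** This ties the real number e to the parity that defines [balanced_cycle]. *)
Lemma cycle_sign_count (R : realType) :
  cycle_sign R adj neg s v0 = (-1) ^+ count (fun x => neg x (next s x)) s.
Proof.
have g3 := shortest_size short.
have -> : (-1) ^+ count (fun x => neg x (next s x)) s =
    \prod_(x <- s) (-1) ^+ neg x (next s x) :> R.
  by elim: {2 3}s => [|x t IH]; rewrite ?big_nil ?big_cons //= exprD IH.
rewrite (big_nth v0) /cycle_sign /path_sign -{3}(ltn_predK g3) big_nat_recr //=.
congr (_ * _).
  apply: eq_big_nat => i /andP[_ ig]; have ig' : (i.+1 < g)%N by lia.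
  by rewrite next_cycle ?(ltnW ig') // ig' sadj_edge // (shortest_edge v0 short).
rewrite sadj_edge ?(shortest_close v0 short) // next_cycle; last by lia.
by case: ltnP => //; lia.
Qed.

End CycleStructure.

Lemma attached_vertex n (adj : rel 'I_n) (s : seq 'I_n) x v :
  connected_graph adj -> x \in s -> v \notin s ->
  exists u w, [/\ u \in s, w \notin s & adj u w].
Proof.
move=> con xs vs; have /connectP[p] := con x v.
elim: p x xs => [x xs _ vx|y p IH x xs /= /andP[xy yp] vl]; first by rewrite vx xs in vs.
by have [ys|ys] := boolP (y \in s); [exact: (IH y) | exists x, y].
Qed.

(** Rotation brings an attachment vertex to position 0, where the pendant bound applies. *)
Lemma shortest_cycle_rot n (adj : rel 'I_n) (s : seq 'I_n) k :
  shortest_cycle adj s -> shortest_cycle adj (rot k s).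
Proof.
case=> cs short; split=> [|t /short]; rewrite ?size_rot // /is_cycle.
by rewrite size_rot rot_uniq rot_cycle.
Qed.

Lemma signr_eq_opp (R : realType) a b : ((-1) ^+ a == - (-1) ^+ b :> R) = (odd a != odd b).
Proof.
rewrite -signr_odd -[(-1) ^+ b]signr_odd.
case: (odd a); case: (odd b); rewrite ?expr0 ?expr1 ?opprK ?eqxx //.
  by rewrite eqNr oner_eq0.
by rewrite eq_sym eqNr oner_eq0.
Qed.

(** * The lower bound and its equality cases *)

Theorem theorem4p1 (R : realType) (n : nat) (adj neg : rel 'I_n) (s : seq 'I_n) :
  simple_graph adj -> sign_sym adj neg -> connected_graph adj ->
  shortest_cycle adj s ->
  let g := size s in
  ((g.+1)./2 - 1 <= ipos R adj neg)%N /\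
  (ipos R adj neg = ((g.+1)./2 - 1)%N <->
     (graph_is_cycle adj s /\
        ((balanced_cycle neg s /\ (g %% 4 == 0 \/ g %% 4 == 3)%N) \/
         (~~ balanced_cycle neg s /\ (g %% 4 == 1 \/ g %% 4 == 2)%N)))
     \/ switch_complete_multipartite adj neg).
Proof.
move=> simpleG signG con short g.
have g3 : (2 < g)%N := shortest_size short.
have [v0 v0s] : exists v, v \in s.
  by move: (shortest_size short); case: (s) => // x p _; exists x; rewrite mem_head.
set m := (g.+1./2 - 1)%N.
have gm : g = m.*2.+2 \/ g = m.*2.+1 by rewrite /m; lia.
have ge_m : (m <= ipos R adj neg)%N := cycle_ipos_ge R v0 simpleG signG short gm.
split=> //.
pose e := cycle_sign R adj neg s v0; pose N := count (fun x => neg x (next s x)) s.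
have eE : e = (-1) ^+ N by apply: cycle_sign_count.
(* The condition (-1)^m = -e in terms of parities: m is odd exactly when [g] is 0 or 3 modulo 4. *)
have parity : (odd m != odd N) <->
  ((balanced_cycle neg s /\ (g %% 4 == 0 \/ g %% 4 == 3)%N) \/
         (~~ balanced_cycle neg s /\ (g %% 4 == 1 \/ g %% 4 == 2)%N)).
  by rewrite /balanced_cycle -/N; case: (odd N) => /=; split; move: gm; lia.
split=> [eq_m|[[[all_s _] /parity mN]|/(multipartite_ipos_le1 R simpleG signG)]]; last first.
(* Since g >= 3 gives m >= 1, the bounds m <= i_+ <= 1 force equality. *)
- rewrite -/(ipos R adj neg) => le1; apply/eqP.
  by rewrite eqn_leq ge_m andbT; move: gm le1; lia.
- apply/eqP; rewrite eqn_leq ge_m andbT.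
  apply: (cycle_ipos_le (v0 := v0) simpleG signG short gm all_s).
  by apply/eqP; rewrite -/e eE signr_eq_opp.
have [g4|g4] := leqP g 4.
  have e01 : adj (nth v0 s 0) (nth v0 s 1) := shortest_edge v0 short (ltnW g3).
  right; apply: (one_positive_multipartite (R := R) simpleG signG con e01).
  by rewrite -/(ipos R adj neg) eq_m; move: gm g4; lia.
left.
(* Otherwise connectedness yields an edge leaving the cycle, and the pendant bound gives i_+ > m. *)
have all_s v : v \in s.
  apply/negPn/negP => vs; have [u [w [us ws uw]]] := attached_vertex con v0s vs.
  pose s' := rot (index u s) s.
  have short' : shortest_cycle adj s' by apply: shortest_cycle_rot.
  have gm' : size s' = m.*2.+2 \/ size s' = m.*2.+1 by rewrite size_rot.
  have u0 : nth v0 s' 0 = u.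
    by rewrite /s' /rot nth_cat size_drop subn_gt0 index_mem us nth_drop addn0 nth_index.
  have := pendant_ipos_gt R (v0 := v0) (v := w) simpleG signG short' gm'.
  rewrite size_rot mem_rot u0 -/(ipos R adj neg) eq_m ltnn => /(_ g4 ws).
  by have [_ ->] := simpleG => /(_ uw).
split; first exact: spanning_shortest_cycle.
apply/parity; rewrite -(signr_eq_opp R); apply/eqP.
(* As e is 1 or -1, excluding (-1)^m = e leaves only (-1)^m = -e. *)
have [em|em] := eqVneq ((-1) ^+ m) e.
  have := cycle_ipos_gt (v0 := v0) simpleG signG short gm em.
  by rewrite -/(ipos R adj neg) eq_m ltnn.
apply/eqP; move: em; rewrite signr_eq_opp eE; apply: contra => /eqP mN.
by rewrite -signr_odd mN signr_odd.
Qed.
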